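(* Let $d\ge1$ and let $V$ be either $(\mathbb R^d,\|\cdot\|_\infty)$ or a $d$-dimensional real inner-product space. Let $U$ be an abelian group with a translation-invariant ultrametric, let $\Lambda\subset V\times U$ be a closed additive subgroup, and let $X=(V\times U)/\Lambda$ carry the quotient metric induced by the maximum product metric. Let $\alpha\in X$ have strict best-return denominators $q_1<q_2<\cdots$ with record distances $r_n=\rho(q_n)$, and let $n\ge1$ be such that $q_{n+P(V)}$ is defined. If $q_n\alpha$ has a representative $e_0=(v_0,u_0)\in V\times U$ such that $$\max\{\|v_0\|_V,|u_0|_U\}=r_n,\qquad |u_0|_U<r_n,$$ then $$q_{n+P(V)}\ge q_n+q_{n+1}.$$
   Context: Metric setting. Write the ultrametric on $U$ as $d_U(u,w)=|u-w|_U$, so $|u+w|_U\le\max\{|u|_U,|w|_U\}$. On $V\times U$ put $|(v,u)|=\max\{\|v\|_V,|u|_U\}$; ''closed'' refers to the induced metric topology. On $X=(V\times U)/\Lambda$ put $\|a+\Lambda\|_X=\inf_{\lambda\in\Lambda}|a-\lambda|$ and $d_X(x,y)=\|x-y\|_X$. A representative of $x\in X$ is an element of the coset $x$. Best returns. For positive integers $q$ put $\rho(q)=d_X(q\alpha,0)$. The strict best-return denominators of $\alpha$ are $q_1=1$ and $q_{n+1}=\min\{q>q_n:\rho(q)<\rho(q_n)\}$ as long as such $q$ exists; the sequence may terminate, and a zero return (if any) is retained as its final term. Packing number. $P(V)$ is the maximal cardinality of a set $S\subset\{v\in V:\|v\|_V<1\}$ (open unit ball) with $\|v-w\|_V\ge1$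 for all distinct $v,w\in S$. This maximum is finite. *)

(* Defs.v *)
From HB Require Import structures.
From mathcomp Require Import all_boot all_order all_algebra.
From mathcomp Require Import ring_quotient sesquilinear finmap.
From mathcomp Require Import all_classical all_reals all_analysis.

Set Implicit Arguments.
Unset Strict Implicit.
Unset Printing Implicit Defensive.

Import Order.TTheory GRing.Theory Num.Theory.
Import numFieldNormedType.Exports.

Local Open Scope classical_set_scope.
Local Open Scope ring_scope.
Local Open Scope quotient_scope.

#[short(type="normedVectType")]
HB.structure Definition NormedVector (R : numFieldType) :=
  {V of NormedModule R V & Vector R V}.

HB.instance Definition _ (R : numFieldType) (d : nat) := Vector.on 'rV[R]_d.

(* An inner-product space is a normed space whose norm is induced by a
   positive definite symmetric bilinear form. *)
Variant sup_or_euclidean (R : realType) (d : nat) : normedVectType R -> Prop :=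
(* The library norm [mx_norm] on ['rV[R]_d] is the sup norm. *)
| SupNormSpace : sup_or_euclidean d 'rV[R]_d
| InnerProductSpace (V : normedVectType R) (dot : {dot V for idfun}) of
    \dim {:V} = d & (forall v : V, `|v| = Num.sqrt (dot v v)) :
    sup_or_euclidean d V.

HB.mixin Record isUltrametricZmodule (R : realType) U
    of PreTopologicalZmodule U := {
  udist : U -> U -> R ;
  udistxx : forall u, udist u u = 0 ;
  udist_positivity : forall u v, udist u v = 0 -> u = v ;
  udist_sym : forall u v, udist u v = udist v u ;
  udist_ultra : forall v u w,
    udist u w <= Num.max (udist u v) (udist v w) ;
  udistD2r : forall w u v, udist (u + w) (v + w) = udist u v ;
  nbhs_udist : forall u : U,
    nbhs u = filter_from [set e : R | 0 < e] (fun e => [set v | udist u v < e])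
}.

#[short(type="ultrametricZmodType")]
HB.structure Definition UltrametricZmodule (R : realType) :=
  {U of PreTopologicalZmodule U & isUltrametricZmodule R U}.

Definition ultra_norm (R : realType) (U : ultrametricZmodType R) (u : U) : R :=
  udist u 0.

Definition max_norm (R : realType) (V : normedVectType R)
    (U : ultrametricZmodType R) (a : V * U) : R :=
  Num.max `|a.1| (ultra_norm a.2).

Lemma ultra_normB (R : realType) (U : ultrametricZmodType R) (u w : U) :
  ultra_norm (u - w) = udist u w.
Proof. by rewrite /ultra_norm -(udistD2r w) subrK add0r. Qed.

(* The library's product topology on [V * U] is the topology of the metric
   [max_norm (a - b)]. *)
Lemma nbhs_max_norm (R : realType) (V : normedVectType R)
    (U : ultrametricZmodType R) (a : V * U) :
  nbhs a = filter_from [set e : R | 0 < e]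
             (fun e => [set b | max_norm (a - b) < e]).
Proof.
have mE (b : V * U) (e : R) :
    (max_norm (a - b) < e) = (`|a.1 - b.1| < e) && (udist a.2 b.2 < e).
  by rewrite /max_norm /= gt_max ultra_normB.
apply/seteqP; split=> A.
- move=> [[B C] /= [/nbhs_ballP[e /= e0 eB]]].
  rewrite nbhs_udist => -[e' /= e'0 eC] BCA.
  exists (Num.min e e'); first by rewrite /= lt_min e0.
  move=> b /=; rewrite mE !lt_min => /andP[/andP[be _] /andP[_ be']].
  by apply: BCA; split; [apply: eB; rewrite -ball_normE|apply: eC].
- move=> [e /= e0 eA].
  exists (ball a.1 e, [set v | udist a.2 v < e]) => /=.
    by split; [exact: nbhsx_ballx|rewrite nbhs_udist; exists e].
  by move=> b [/=]; rewrite -ball_normE /= => ? ?; apply: eA; rewrite /= mE; apply/andP.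
Qed.

Section Quotient.
Variables (R : realType) (V : normedVectType R) (U : ultrametricZmodType R).
Variable L : zmodClosed (V * U)%type.

Definition quot_norm (x : (Quotient.quot L)) : R :=
  inf [set max_norm (repr x - l) | l in [set l | l \in L]].

Definition quot_dist (x y : (Quotient.quot L)) : R := quot_norm (x - y).

Definition return_dist (alpha : (Quotient.quot L)) (q : nat) : R :=
  quot_dist (alpha *+ q) 0.

Lemma quot_normE (a : V * U) :
  quot_norm (\pi_(Quotient.quot L) a) =
  inf [set max_norm (a - l) | l in [set l | l \in L]].
Proof.
congr inf; have Lra : repr (\pi_(Quotient.quot L) a) - a \in L.
  by rewrite Quotient.idealrBE reprK.
apply/seteqP; split=> _ [l /= Ll <-].
- exists (l - (repr (\pi_(Quotient.quot L) a) - a)); first exact: rpredB.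
  by congr max_norm; rewrite opprB addrA [a + _]addrC subrK.
- exists (l + (repr (\pi_(Quotient.quot L) a) - a)); first exact: rpredD.
  by congr max_norm; rewrite opprD opprB addrCA [repr _ + _]addrC subrK addrC.
Qed.

End Quotient.

Definition next_best_return (R : realType) (rho : nat -> R) (q q' : nat) :=
  [/\ (q < q')%N, rho q' < rho q &
      forall k, (q < k)%N -> rho k < rho q -> (q' <= k)%N].

(* [q 1, ..., q N] are the first [N] best-return denominators, indexed from 1;
   in particular at least [N] of them exist. The other values of [q] are
   irrelevant. *)
Definition best_returns_upto (R : realType) (rho : nat -> R) (N : nat)
    (q : nat -> nat) :=
  q 1%N = 1%N /\
  forall i, (1 <= i < N)%N -> next_best_return rho (q i) (q i.+1).

Definition unit_packing (R : realType) (V : normedVectType R)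
    (S : {fset V}) : Prop :=
  (forall v, v \in S -> `|v| < 1) /\
  {in S &, forall v w, v != w -> 1 <= `|v - w|}.

(* The maximal cardinality of a packing; the default 0 is taken only if there
   is no maximum. An infinite packing would have finite subpackings of every
   cardinality, so finite sets suffice. *)
Definition packing_number (R : realType) (V : normedVectType R) : nat :=
  xget 0%N [set p | (exists2 S : {fset V}, unit_packing S & #|` S| = p) /\
                    (forall S : {fset V}, unit_packing S -> (#|` S| <= p)%N)].

(* Main.v *)
(* Suppose q_(n+p) < q_n + q_(n+1) with p = P(V). Any two of the p + 1 numbers
   q_n, ..., q_(n+p) then differ by less than q_(n+1), so the difference
   returns at distance at least r_n. Choose representatives of
   q_(n+1) alpha, ..., q_(n+p) alpha of norm less than r_n, and e_0 for q_n alpha.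
   All their U-components are smaller than r_n, hence so are the differences of
   these by the ultrametric inequality, and the V-components must be pairwise
   at distance at least r_n. Thus V contains p points of the open ball of
   radius r_n and one point of its boundary sphere, all r_n-separated. Such a
   configuration can be moved inside the open unit ball, keeping separation 1,
   which contradicts the maximality of p: for the sup norm replace each
   coordinate by +-1/2 according to its sign; for a Euclidean norm the vectors
   subtend angles larger than 60 degrees, so project them radially to a sphere
   of radius slightly less than 1. *)
Require Import Defs.
From HB Require Import structures.
From mathcomp Require Import all_boot all_order all_algebra.
From mathcomp Require Import ring_quotient sesquilinear finmap.
From mathcomp Require Import all_classical all_reals all_analysis.
From mathcomp Require Import lra.

Set Implicit Arguments.
Unset Strict Implicit.
Unset Printing Implicit Defensive.

Import Order.TTheory GRing.Theory Num.Theory.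
Import numFieldNormedType.Exports.

Local Open Scope classical_set_scope.
Local Open Scope ring_scope.
Local Open Scope quotient_scope.

(** * Finiteness of the packing number *)

Lemma unit_packing_fun (R : realType) (V : normedVectType R) (I : finType)
    (f : I -> V) :
    (forall i, `|f i| < 1) -> (forall i j, i != j -> 1 <= `|f i - f j|) ->
  exists2 S : {fset V}, unit_packing S & #|` S| = #|I|.
Proof.
move=> f1 fsep; exists [fset f i | i in I]%fset.
  split=> [_ /imfsetP[i _ ->]//|_ _ /imfsetP[i _ ->] /imfsetP[j _ ->] neq].
  by apply: fsep; apply: contra_neq neq => ->.
rewrite card_imfset/= ?cardE // => i j fij; apply/eqP/negPn/negP => /fsep.
by rewrite fij subrr normr0 ler10.
Qed.

Lemma lincomb_continuous (R : realType) (V : normedModType R) (n : nat)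
    (b : 'I_n -> V) : continuous (fun x : 'rV[R]_n => \sum_i x ord0 i *: b i).
Proof.
apply: continuous_big => [|i _ x]; first exact: add_continuous.
by apply: cvgZr_tmp; [exact: (nbhs_filter x)|exact: (@coord_continuous R 1 n ord0 i x)].
Qed.

(** On the compact unit sphere of coordinate vectors the norm of the linear combination attains its
    minimum, positive because a basis is free; homogeneity extends the bound to all [x]. *)
Lemma coords_norm_ge (R : realType) (V : normedVectType R) :
  exists2 m : R, 0 < m & forall x : 'rV[R]_(\dim {:V}),
    m * `|x| <= `|\sum_i x ord0 i *: (vbasis {:V})`_i|.
Proof.
set b := vbasis {:V}.
pose f (x : 'rV[R]_(\dim {:V})) := \sum_i x ord0 i *: b`_i.
have fZ a x : f (a *: x) = a *: f x.
  by rewrite /f scaler_sumr; apply: eq_bigr => i _; rewrite mxE scalerA.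
have fcont : continuous f by exact: lincomb_continuous.
have f_inj x : f x = 0 -> x = 0.
  move=> fx0; apply/rowP => i; rewrite mxE.
  have /freeP : free b by exact: (basis_free (vbasisP _)).
  by move/(_ (fun i => x ord0 i)); apply.
(* If the sphere is empty, every [x] is zero and any [m] works. *)
have [S0|S0] := pselect ([set x : 'rV[R]_(\dim {:V}) | `|x| = 1] !=set0); last first.
  exists 1 => // x; rewrite (_ : x = 0) ?normr0 ?mulr0 ?normr_ge0 //.
  apply: contrapT => /eqP x0; apply: S0; exists (`|x|^-1 *: x) => /=.
  by rewrite normrZ normfV normr_id mulVf ?normr_eq0.
have cS : compact [set x : 'rV[R]_(\dim {:V}) | `|x| = 1].
  apply: bounded_closed_compact.
    exists 1; split; first exact: num_real.
    by move=> M M1 x /= ->; apply: ltW.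
  apply: (@closed_comp _ _ (fun x : 'rV[R]_(\dim {:V}) => `|x|) [set 1]) => //.
    by move=> x _; apply: norm_continuous.
have [|c] := @EVT_min_rV R _ (fun x => `|f x|) _ S0 cS.
  apply: continuous_subspaceT => x.
  by apply: (@continuous_comp _ _ _ f); [exact: fcont|exact: norm_continuous].
rewrite inE /= => c1 cmin; exists `|f c|.
  rewrite normr_gt0; apply/eqP => /f_inj c0.
  by move: c1; rewrite c0 normr0 => /eqP; rewrite eq_sym oner_eq0.
move=> x; have [->|x0] := eqVneq x 0; first by rewrite normr0 mulr0.
rewrite -ler_pdivlMr ?normr_gt0 // -/(f x).
have -> : `|f x| / `|x| = `|f (`|x|^-1 *: x)|.
  by rewrite fZ normrZ normfV normr_id mulrC.
apply: cmin; rewrite inE /= normrZ normfV normr_id mulVf //.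
by rewrite normr_eq0.
Qed.

(** Vectors of the open unit ball have coordinates in a compact set, whose image is covered by
    finitely many balls of radius 1/2; each of these contains at most one point of a packing. *)
Lemma unit_packing_bounded (R : realType) (V : normedVectType R) :
  exists N : nat, forall S : {fset V}, unit_packing S -> (#|` S| <= N)%N.
Proof.
have [m m0 mle] := coords_norm_ge V.
set b := vbasis {:V} in mle.
pose f (x : 'rV[R]_(\dim {:V})) := \sum_i x ord0 i *: b`_i.
have fcont : continuous f by exact: lincomb_continuous.
have : compact [set x : 'rV[R]_(\dim {:V}) | `|x| <= m^-1].
  apply: bounded_closed_compact.
    exists m^-1; split; first exact: num_real.
    by move=> M M1 x /= /le_trans; apply; apply: ltW.
  apply: (@closed_comp _ _ (fun x : 'rV[R]_(\dim {:V}) => `|x|) [set x | x <= m^-1]) => //.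
    by move=> x _; apply: norm_continuous.
rewrite compact_cover => /(_ _ setT (fun x => f @^-1` (ball (f x) 2^-1))).
case=> [x _|x _|D _ cov].
- apply: open_comp; first by move=> y _; exact: fcont.
  exact: ball_open.
- by exists x => //=; apply: ballxx; rewrite invr_gt0.
exists #|` D| => S [S1 Ssep].
have /choice[g gP] v : exists x, v \in S -> x \in D /\ `|f x - v| < 2^-1.
  have [vS|_] := boolP (v \in S); last by exists 0.
  pose x : 'rV[R]_(\dim {:V}) := \row_i coord b i v.
  have fx : f x = v.
    rewrite [RHS](coord_vbasis (memvf v)); apply: eq_bigr => i _.
    by rewrite mxE.
  have [|y /= yD xy] := cov x.
    rewrite /= -[leRHS]mulr1 mulrC ler_pdivlMr // mulrC (le_trans (mle x)) //.
    by rewrite -/(f x) fx ltW // S1.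
  by exists y => _; split=> //; move: xy; rewrite -ball_normE /= fx.
have /card_in_imfsetP/eqP <- : {in S &, injective g}.
  move=> v w vS wS /= gvw; apply/eqP/negPn/negP => /(Ssep _ _ vS wS).
  have [[_ gv] [_ gw]] := (gP v vS, gP w wS); apply/negP; rewrite -ltNge.
  rewrite (_ : v - w = (f (g w) - w) - (f (g v) - v)); last first.
    by rewrite gvw opprB [RHS]addrC addrA subrK.
  rewrite (le_lt_trans (ler_normB _ _)) // (lt_le_trans (ltrD gw gv)) //.
  by lra.
apply: fsubset_leq_card; apply/fsubsetP => _ /imfsetP[v /= vS ->].
by have [] := gP v vS.
Qed.

(** The uniform bound makes the maximum exist, so [xget] does not fall back on its default. *)
Lemma packing_number_max (R : realType) (V : normedVectType R) (S : {fset V}) :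
  unit_packing S -> (#|` S| <= packing_number V)%N.
Proof.
move: S; rewrite /packing_number; have [N NP] := unit_packing_bounded V.
pose P k := `[< exists2 S : {fset V}, unit_packing S & #|` S| = k >].
have P0 : exists k, P k.
  by exists 0%N; apply/asboolP; exists fset0; [split|rewrite cardfs0].
have PN k : P k -> (k <= N)%N by move=> /asboolP[S /NP + <-].
have [p /asboolP Pp pmax] := ex_maxnP P0 PN.
case: xgetP => [_ _ []//|/(_ p)[]].
by split=> // S Sp; apply: pmax; apply/asboolP; exists S.
Qed.

(** * Moving a spread configuration into the open unit ball *)

(** Coordinates on the same side of 0 differ by less than [r], so [r]-separated vectors have
    different sign patterns, and the new points differ by 1 in some coordinate. *)
Lemma spread_packing_sup (R : realType) (d : nat) (I : finType) (i0 : I) (r : R)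
    (v : I -> 'rV[R]_d) :
    0 < r -> `|v i0| = r -> (forall i, i != i0 -> `|v i| < r) ->
    (forall i j, i != j -> r <= `|v i - v j|) ->
  exists2 f : I -> 'rV[R]_d, (forall i, `|f i| < 1) &
    forall i j, i != j -> 1 <= `|f i - f j|.
Proof.
move=> r0 v0r vltr vsep.
have entry_le (x : 'rV[R]_d) k : `|x ord0 k| <= `|x|.
  rewrite [leRHS]/Num.norm /= mx_normrE.
  by apply: (le_bigmax_cond _ (fun ij => `|x ij.1 ij.2|) (j := (ord0, k))).
(* The sign of [v i0 ord0 k] decides on which side [0] is counted, so that
   two vectors on the same side differ by less than [r] at [k] even if one
   of them is [v i0]. *)
pose pos i k := if 0 <= v i0 ord0 k then 0 < v i ord0 k else 0 <= v i ord0 k.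
pose f i : 'rV[R]_d := \row_k (if pos i k then 2^-1 else - 2^-1).
have same_side i j k : i != j -> pos i k = pos j k ->
    `|v i ord0 k - v j ord0 k| < r.
  have bnd l : [/\ - r <= v l ord0 k, v l ord0 k <= r &
      l = i0 \/ (- r < v l ord0 k /\ v l ord0 k < r)].
    have [->|li0] := eqVneq l i0.
      by split; [| |left] => //; have := entry_le (v i0) k;
        rewrite v0r ler_norml => /andP[].
    have := le_lt_trans (entry_le (v l) k) (vltr _ li0).
    by rewrite ltr_norml => /andP[? ?]; split; [exact: ltW|exact: ltW|right].
  rewrite /pos ltr_norml => ij.
  have [[i1 i2 iE] [j1 j2 jE]] := (bnd i, bnd j).
  case: iE => [ii0|[]]; case: jE => [ji0|[]].
  - by rewrite ii0 ji0 eqxx in ij.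
  - move: i1 i2; rewrite ii0.
    case: (leP 0 (v i0 ord0 k)) => ?; last by case: leP => //; lra.
    by case: (ltP 0 (v i0 ord0 k)); case: (ltP 0 (v j ord0 k)) => //; lra.
  - move: j1 j2; rewrite ji0.
    case: (leP 0 (v i0 ord0 k)) => ?; last by case: leP => //; lra.
    by case: (ltP 0 (v i ord0 k)); case: (ltP 0 (v i0 ord0 k)) => //; lra.
  - case: ifP => _.
      by case: (ltP 0 (v i ord0 k)); case: (ltP 0 (v j ord0 k)) => //; lra.
    by case: (leP 0 (v i ord0 k)); case: (leP 0 (v j ord0 k)) => //; lra.
exists f => [i|i j ij].
  rewrite (@le_lt_trans _ _ 2^-1) //; last by lra.
  rewrite [leLHS]/Num.norm /= mx_normrE; apply: bigmax_le => [|[a b] _].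
    by rewrite invr_ge0.
  by rewrite mxE /=; case: ifP => _; rewrite ?normrN ger0_norm ?invr_ge0.
have /negP/negP : ~~ [forall k, pos i k == pos j k].
  apply/negP => /forallP same; have := vsep _ _ ij; apply/negP; rewrite -ltNge.
  rewrite [ltLHS]/Num.norm /= mx_normrE; apply: bigmax_lt => // -[a b] _ /=.
  by rewrite !mxE ord1; apply: same_side => //; apply/eqP.
rewrite negb_forall => /existsP[k neqk]; apply: le_trans (entry_le _ k).
rewrite !mxE; case: (pos i k) (pos j k) neqk => -[] // _.
  by rewrite opprK ger0_norm; lra.
by rewrite ler0_norm; lra.
Qed.

Lemma spread_packing_inner (R : realType) (V : normedVectType R)
    (dot : {dot V for idfun}) (I : finType) (i0 : I) (r : R) (v : I -> V) :
    (forall x, `|x| = Num.sqrt (dot x x)) ->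
    0 < r -> `|v i0| = r -> (forall i, i != i0 -> `|v i| < r) ->
    (forall i j, i != j -> r <= `|v i - v j|) ->
  exists2 f : I -> V, (forall i, `|f i| < 1) &
    forall i j, i != j -> 1 <= `|f i - f j|.
Proof.
move=> normE r0 v0r vltr vsep.
have dotxx x : dot x x = `|x| ^+ 2.
  rewrite normE sqr_sqrtr //; have [->|x0] := eqVneq x 0.
    by rewrite linear0l.
  exact/ltW/neq0_dnorm_gt0.
have normB x y : `|x - y| ^+ 2 = `|x| ^+ 2 + `|y| ^+ 2 - 2 * dot x y.
  by rewrite -!dotxx hnormB /= expr0 mul1r -mulr2n mulr_natl.
(* A zero vector forces all others to norm at least [r], which only [v i0] has; two opposite vectors
   of norm 1/2 then suffice. *)
have [[j vj0]|v_neq0] := pselect (exists j, v j = 0).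
  have ji0 : j != i0.
    by apply/eqP => ji0; move: r0; rewrite -v0r -ji0 vj0 normr0 ltxx.
  have Ij i : i != i0 -> i = j.
    move=> ii0; apply/eqP/negPn/negP => /vsep.
    by rewrite vj0 subr0 leNgt vltr.
  pose w := r^-1 *: v i0.
  have w1 : `|w| = 1.
    by rewrite normrZ v0r normfV gtr0_norm // mulVf // gt_eqF.
  pose f i : V := if i == i0 then 2^-1 *: w else - (2^-1 *: w).
  have f2 i : `|f i| = 2^-1.
    by rewrite /f; case: ifP => _; rewrite ?normrN normrZ w1 mulr1 ger0_norm.
  have e : 2^-1 *: w + 2^-1 *: w = w.
    by rewrite -scalerDl (_ : 2^-1 + 2^-1 = 1) ?scale1r //; lra.
  exists f => [i|i k ik]; first by rewrite f2; lra.
  rewrite /f; case: (eqVneq i i0) => [ii0|/Ij ii].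
    by case: eqP => [ki0|_]; [rewrite ii0 ki0 eqxx in ik|rewrite opprK e w1].
  case: eqP => [_|/eqP/Ij kj]; last by rewrite ii kj eqxx in ik.
  by rewrite -opprD normrN e w1.
have vpos i : 0 < `|v i|.
  by rewrite normr_gt0; apply/eqP => vi0; apply: v_neq0; exists i.
have vler i : `|v i| <= r.
  by have [->|/vltr/ltW//] := eqVneq i i0; rewrite v0r.
(* The side opposite to the angle at the origin is strictly longer than one
   of the two others and at least as long as the third one, so that this
   angle exceeds 60 degrees. *)
have angle i j : i != j -> 2 * dot (v i) (v j) < `|v i| * `|v j|.
  move=> ij; have := vsep _ _ ij.
  rewrite -(@ler_pXn2r _ 2) ?nnegrE ?(ltW r0) ?normr_ge0 // normB => sep.
  have : `|v i| < r \/ `|v j| < r.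
    have [ii0|/vltr] := eqVneq i i0; last by left.
    by right; apply: vltr; rewrite -ii0 eq_sym.
  have := vler i; have := vler j; have := vpos i; have := vpos j.
  move: sep; move: (dot _ _) `|v i| `|v j| => D a b sep b0 a0 br ar [ar'|br'].
    by nra.
  by nra.
pose w i := `|v i|^-1 *: v i.
have w1 i : `|w i| = 1.
  by rewrite normrZ normfV normr_id mulVf // gt_eqF.
(* Unit vectors with inner product below 1/2 are more than 1 apart; strictness leaves room for
   shrinking. *)
have wsep i j : i != j -> 1 < `|w i - w j|.
  move=> ij; rewrite -(@ltr_pXn2r _ 2) ?nnegrE ?normr_ge0 // normB !w1.
  have -> : dot (w i) (w j) = `|v i|^-1 * (`|v j|^-1 * dot (v i) (v j)).
    by rewrite linearZl_LR linearZr_LR.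
  have : 2 * dot (v i) (v j) / (`|v i| * `|v j|) < 1.
    by rewrite ltr_pdivrMr ?mulr_gt0 // mul1r angle.
  by rewrite invfM expr1n; lra.
(* Scaling by [t] keeps all distances at least 1. Finitely many pairs give [t < 1]; the default 1/2
   keeps [t] positive even without pairs. *)
pose t := \big[Num.max/2^-1]_(p : I * I | p.1 != p.2) `|w p.1 - w p.2|^-1.
have t1 : t < 1.
  apply: bigmax_lt => [|[i j] /= ij]; first by lra.
  by rewrite invf_lt1 ?wsep // (lt_trans ltr01) // wsep.
have t0 : 0 < t by apply: lt_le_trans (bigmax_ge_id _ _ _ _); lra.
exists (fun i => t *: w i) => [i|i j ij].
  by rewrite normrZ w1 mulr1 gtr0_norm.
rewrite -scalerBr normrZ gtr0_norm // -ler_pdivrMr ?div1r.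
  exact: (le_bigmax_cond _ (fun p : I * I => `|w p.1 - w p.2|^-1) (j := (i, j))).
by rewrite (lt_trans ltr01) ?wsep.
Qed.

Lemma spread_packing (R : realType) (d : nat) (V : normedVectType R)
    (hV : sup_or_euclidean d V) (I : finType) (i0 : I) (r : R) (v : I -> V) :
    0 < r -> `|v i0| = r -> (forall i, i != i0 -> `|v i| < r) ->
    (forall i j, i != j -> r <= `|v i - v j|) ->
  exists2 f : I -> V, (forall i, `|f i| < 1) &
    forall i j, i != j -> 1 <= `|f i - f j|.
Proof.
case: hV v => [v|{}V dot _ normE v]; first exact: spread_packing_sup.
exact: spread_packing_inner.
Qed.

(** * Norms on [U] and on the quotient *)

Lemma ultra_norm_ge0 (R : realType) (U : ultrametricZmodType R) (u : U) :
  0 <= ultra_norm u.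
Proof.
by have := udist_ultra (0 : U) u u; rewrite udistxx [udist 0 u]udist_sym maxxx.
Qed.

Lemma ultra_normB_lt (R : realType) (U : ultrametricZmodType R) (r : R)
    (u w : U) :
  ultra_norm u < r -> ultra_norm w < r -> ultra_norm (u - w) < r.
Proof.
rewrite ultra_normB => ur wr; apply: le_lt_trans (udist_ultra 0 u w) _.
by rewrite gt_max [udist 0 w]udist_sym ur.
Qed.

Lemma quot_norm_le (R : realType) (V : normedVectType R)
    (U : ultrametricZmodType R) (L : zmodClosed (V * U)%type) (a : V * U) :
  quot_norm (\pi_(Quotient.quot L) a) <= max_norm a.
Proof.
rewrite quot_normE; apply: ge_inf; last first.
  by exists 0; [exact: rpred0|rewrite subr0].
by exists 0 => _ [l _ <-]; rewrite /max_norm le_max normr_ge0.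
Qed.

(** The infimum need not be attained, but some representative already lies below any strict upper
    bound. *)
Lemma quot_norm_lt (R : realType) (V : normedVectType R)
    (U : ultrametricZmodType R) (L : zmodClosed (V * U)%type)
    (x : Quotient.quot L) (r : R) :
  quot_norm x < r ->
  exists2 a : V * U, \pi_(Quotient.quot L) a = x & max_norm a < r.
Proof.
case/inf_lt => [|_ [l /= lL <-] lr].
  by exists (max_norm (repr x - 0)); exists 0 => //; exact: rpred0.
exists (repr x - l) => //; rewrite -[RHS]reprK; apply/eqP.
by rewrite -Quotient.idealrBE addrAC subrr sub0r rpredN.
Qed.

(** * Order properties of best returns *)

Lemma best_returns_mono (R : realType) (rho : nat -> R) (N : nat)
    (q : nat -> nat) (hq : best_returns_upto rho N q) (i j : nat) :
  (1 <= i < j)%N -> (j <= N)%N ->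
  (q i < q j)%N /\ rho (q j) < rho (q i).
Proof.
case/andP => i1; elim: j => [|j IHj] // ij jN.
have [|lt_j rho_j _] := hq.2 j; first by rewrite jN (leq_trans i1).
move: ij; rewrite ltnS leq_eqVlt => /orP[/eqP->//|/IHj[|lt_ij rho_ij]].
  exact: ltnW.
by split; [exact: ltn_trans lt_j|exact: lt_trans rho_ij].
Qed.

(** Minimality of [q i.+1] handles [k] beyond [q i]; for [k] before [q i], induction and the
    decrease of the records apply. *)
Lemma best_returns_min (R : realType) (rho : nat -> R) (N : nat)
    (q : nat -> nat) (hq : best_returns_upto rho N q) (i k : nat) :
  (1 <= i < N)%N -> (0 < k < q i.+1)%N ->
  rho (q i) <= rho k.
Proof.
elim: i k => [|i IHi] k //= iN /andP[k0 kq].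
have [|_ _ minq] := hq.2 i.+1; first by [].
rewrite leNgt; apply/negP => rhok.
have [qk|] := ltnP (q i.+1) k; first by have := minq _ qk rhok; rewrite leqNgt kq.
rewrite leq_eqVlt => /orP[/eqP kE|kq1]; first by rewrite kE ltxx in rhok.
(* For the first record, [q 1 = 1] leaves no positive [k] below it. *)
case: i IHi iN kq minq rhok kq1 => [|i] IHi iN kq minq rhok kq1.
  by rewrite hq.1 ltnNge k0 in kq1.
have [||_] := best_returns_mono hq (i := i.+1) (j := i.+2);
  [exact: ltnSn|exact: ltnW|].
apply/negP; rewrite -leNgt (le_trans _ (ltW rhok)) // IHi ?k0 //.
exact: ltnW.
Qed.

Theorem proposition3 (R : realType) (d : nat) (hd : (1 <= d)%N)
    (V : normedVectType R) (hV : sup_or_euclidean d V)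
    (U : ultrametricZmodType R)
    (L : zmodClosed (V * U)%type) (hL : closed [set a : V * U | a \in L])
    (alpha : (Quotient.quot L)) (q : nat -> nat) (n : nat) (hn : (1 <= n)%N)
    (hq : best_returns_upto (return_dist alpha) (n + packing_number V) q)
    (v0 : V) (u0 : U)
    (he0 : \pi_(Quotient.quot L) (v0, u0) = alpha *+ q n)
    (hmax : Num.max `|v0| (ultra_norm u0) = return_dist alpha (q n))
    (hu0 : ultra_norm u0 < return_dist alpha (q n)) :
  (q n + q n.+1 <= q (n + packing_number V))%N.
Proof.
rewrite leqNgt; apply/negP => qlt.
set p := packing_number V in hq qlt.
set r := return_dist alpha (q n) in hmax hu0.
(* The strict bound on [u0] forces [r > 0] and puts [v0] on the sphere of radius [r]. *)
have r0 : 0 < r by exact: le_lt_trans (ultra_norm_ge0 _) hu0.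
have v0r : `|v0| = r.
  by move: hmax; case: (leP `|v0|) => // _ u0r; rewrite u0r ltxx in hu0.
have /choice[e eP] (i : 'I_p.+1) : exists e : V * U,
    [/\ \pi_(Quotient.quot L) e = alpha *+ q (n + i)%N, ultra_norm e.2 < r &
        if i == ord0 then e.1 = v0 else `|e.1| < r].
  have [->|i0] := eqVneq i ord0; first by exists (v0, u0); rewrite addn0.
  have [||_ rho_i] := best_returns_mono hq (i := n) (j := n + i).
  - by rewrite hn -[ltnLHS]addn0 ltn_add2l lt0n.
  - by rewrite leq_add2l -ltnS.
  move: rho_i; rewrite -/r /return_dist /quot_dist subr0.
  case/quot_norm_lt => a aE; rewrite gt_max => /andP[a1 a2].
  by exists a.
have sep_lt (i j : 'I_p.+1) : (i < j)%N -> r <= `|(e j).1 - (e i).1|.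
  move=> ij; have [[eiE ui _] [ejE uj _]] := (eP i, eP j).
  have jp : (j <= p)%N by rewrite -ltnS.
  have p0 : (0 < p)%N by rewrite (leq_trans _ jp) // (leq_ltn_trans _ ij).
  have [||qij _] := best_returns_mono hq (i := n + i) (j := n + j).
  - by rewrite ltn_add2l ij andbT ltn_addr.
  - by rewrite leq_add2l.
  have qjp : (q (n + j) <= q (n + p))%N.
    move: jp; rewrite leq_eqVlt => /orP[/eqP->//|jp].
    have [|//|/ltnW//] := best_returns_mono hq (i := n + j) (j := n + p).
    by rewrite ltn_add2l jp andbT ltn_addr.
  have qni : (q n <= q (n + i))%N.
    have [->|i0] := posnP i; first by rewrite addn0.
    have [||/ltnW//] := best_returns_mono hq (i := n) (j := n + i).
    - by rewrite hn -[ltnLHS]addn0 ltn_add2l.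
    - by rewrite leq_add2l (leq_trans (ltnW ij)).
  (* The chain is [q (n + j) <= q (n + p) < q n + q n.+1 <= q (n + i) + q n.+1]. *)
  have diff_lt : (q (n + j) - q (n + i) < q n.+1)%N.
    rewrite ltn_subLR ?(ltnW qij) // (leq_ltn_trans qjp) // (leq_trans qlt) //.
    by rewrite leq_add2r.
  have : r <= return_dist alpha (q (n + j) - q (n + i)).
    apply: (best_returns_min hq); last by rewrite subn_gt0 qij.
    by rewrite hn -[ltnLHS]addn0 ltn_add2l.
  (* The difference of the representatives represents this return; its [U]-part is below [r], so its
     [V]-part must reach [r]. *)
  rewrite /return_dist /quot_dist subr0 mulrnBr; last exact: ltnW.
  rewrite -eiE -ejE -raddfB => /le_trans /(_ (quot_norm_le _ _)).
  by rewrite /max_norm le_max [X in _ || X]leNgt ultra_normB_lt // orbF.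
have sep (i j : 'I_p.+1) : i != j -> r <= `|(e i).1 - (e j).1|.
  rewrite neq_ltn => /orP[|] ij; last exact: sep_lt.
  by rewrite distrC sep_lt.
have [f f1 fsep] : exists2 f : 'I_p.+1 -> V, (forall i, `|f i| < 1) &
    forall i j, i != j -> 1 <= `|f i - f j|.
  apply: (spread_packing hV (i0 := ord0) r0 _ _ sep) => [|i i0].
    by have [_ _ ->] := eP ord0.
  by have [_ _] := eP i; rewrite (negbTE i0).
have [S Sp cS] := unit_packing_fun f1 fsep.
by have := packing_number_max Sp; rewrite cS card_ord ltnn.
Qed.
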